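(* Let $e\ge 2$ be an integer, $p$ a prime and $r\ge 1$ an integer with $p^r\equiv 1 \pmod e$. Fix a generator $\gamma$ of $\mathbb{F}_{p^r}^\times$, let $n\ge 1$ be an integer, and fix a generator $\lambda$ of $\mathbb{F}_{p^{nr}}^\times$ such that $\mathrm{Nr}(\lambda)\gamma^{-1}$ is an $e$-th power in $\mathbb{F}_{p^r}^\times$, where $\mathrm{Nr}:\mathbb{F}_{p^{nr}}\to\mathbb{F}_{p^r}$ is the norm. Let $C_r$ be the multiplication matrix of the Gaussian periods of degree $e$ for $\mathbb{F}_{p^r}$ with respect to $\gamma$, and $C_{nr}$ that for $\mathbb{F}_{p^{nr}}$ with respect to $\lambda$. Then \[ C_{nr}=(-1)^{n-1}C_r^{(n)}, \] where $C_r^{(n)}=C_r\overset{-1}{\ast}\cdots\overset{-1}{\ast}C_r$ ($n$ factors). In particular $P_{e,nr}(X)=\mathrm{Char}_X\big((-1)^{n-1}C_r^{(n)}\big)$, where $P_{e,nr}(X)=\prod_{i=0}^{e-1}(X-\eta_{nr}(i))$ and $\mathrm{Char}_X$ denotes the characteristic polynomial.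
   Context: For a prime power $q=p^m$ with $q\equiv1\pmod e$, write $q=ef+1$, let $\zeta_p=e^{2\pi i/p}$, $\mathrm{Tr}:\mathbb{F}_q\to\mathbb{F}_p$ the trace, and $\beta$ a generator of $\mathbb{F}_q^\times$. Gaussian periods: $\eta(i)=\sum_{j=0}^{f-1}\zeta_p^{\mathrm{Tr}(\beta^{ej+i})}$, $i\in\mathbb{Z}/e\mathbb{Z}$. Cyclotomic numbers: for $0\le i,j\le e-1$, $\mathrm{Cyc}(i,j)=\#\{(v_1,v_2):0\le v_1,v_2\le f-1,\ 1+\beta^{ev_1+i}=\beta^{ev_2+j}\text{ in }\mathbb{F}_q\}$. Let $D_i=1$ if $-1\in\beta^{i}(\mathbb{F}_q^\times)^e$ and $D_i=0$ otherwise. The multiplication matrix is the $e\times e$ matrix $C=[\mathrm{Cyc}(i,j)-D_if]_{0\le i,j\le e-1}$ (it satisfies $\eta(m)\eta(m+i)=\sum_j(\mathrm{Cyc}(i,j)-D_if)\eta(m+j)$). For $e\times e$ matrices $A=[a_{i,j}]$, $B=[b_{i,j}]$ (indices in $\mathbb{Z}/e\mathbb{Z}$) and $d\in(\mathbb{Z}/e\mathbb{Z})\setminus\{0\}$, the $d$-composition is $A\overset{d}{\ast}B=\big[\sum_{s=0}^{e-1}\sum_{t=0}^{e-1}a_{s,t}b_{ds+i,dt+j}\big]_{0\le i,j\le e-1}$; the $(-1)$-composition is associative, so the $n$-fold product is well defined. *)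

(* Defs.v *)
From HB Require Import structures.
From mathcomp Require Import all_boot all_order all_algebra all_field.
Set Implicit Arguments. Unset Strict Implicit. Unset Printing Implicit Defensive.
Import Order.TTheory GRing.Theory Num.Theory.
Local Open Scope ring_scope.

Definition is_generator (F : finFieldType) (x : F) : Prop :=
  x != 0 /\ forall y : F, y != 0 -> exists k : nat, y = x ^+ k.

(* Norm of the degree-n extension L / K (K of size q): product of the
   Frobenius conjugates x^(q^i), i < n. *)
Definition ffnorm (K L : finFieldType) (n : nat) (x : L) : L :=
  \prod_(i < n) x ^+ (#|K| ^ i)%N.

Definition fpart (F : finFieldType) (e : nat) : nat := ((#|F|.-1) %/ e)%N.

Definition cyc_num (F : finFieldType) (e : nat) (beta : F) (i j : nat) : nat :=
  #|[set v : 'I_(fpart F e) * 'I_(fpart F e) |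
      1 + beta ^+ (e * v.1 + i)%N == beta ^+ (e * v.2 + j)%N]|.

Definition Dind (F : finFieldType) (e : nat) (beta : F) (i : nat) : bool :=
  [exists y : F, (y != 0) && (- 1 == beta ^+ i * y ^+ e)].

Definition mult_matrix (F : finFieldType) (e : nat) (beta : F) : 'M[int]_e :=
  \matrix_(i < e, j < e)
    ((cyc_num e beta i j)%:Z - (if Dind e beta i then fpart F e else 0%N)%:Z).

Lemma modI_proof (e : nat) (k : int) (i0 : 'I_e) : (absz (k %% e%:Z)%Z < e)%N.
Proof.
have e0 : (0 < e)%N := leq_ltn_trans (leq0n _) (ltn_ord i0).
rewrite -ltz_nat gez0_abs ?modz_ge0 ?ltz_pmod //; by rewrite ?ltz_nat // eqz_nat -lt0n.
Qed.

Definition modI (e : nat) (k : int) (i0 : 'I_e) : 'I_e := Ordinal (modI_proof k i0).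

Definition dcomp (e : nat) (d : int) (A B : 'M[int]_e) : 'M[int]_e :=
  \matrix_(i < e, j < e)
    \sum_(s < e) \sum_(t < e)
      A s t * B (modI (d * (s : nat)%:Z + (i : nat)%:Z) i)
                (modI (d * (t : nat)%:Z + (j : nat)%:Z) j).

Definition dcomp_pow (e : nat) (A : 'M[int]_e) (n : nat) : 'M[int]_e :=
  iter n.-1 (fun X => dcomp (-1) X A) A.

(* absolute trace F -> F_p (F of size p^m) *)
Definition ftrace (F : finFieldType) (p m : nat) (x : F) : F :=
  \sum_(k < m) x ^+ (p ^ k)%N.

Definition trace_nat (F : finFieldType) (p m : nat) (x : F) : nat :=
  if [pick k : 'I_p | ftrace p m x == (k : nat)%:R] is Some k then val k else 0%N.

(* Gaussian period eta(i), with zeta_p = z *)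
Definition gperiod (F : finFieldType) (p m e : nat) (z : algC) (beta : F) (i : nat)
  : algC :=
  \sum_(j < fpart F e) z ^+ trace_nat p m (beta ^+ (e * j + i)%N).

Definition period_poly (F : finFieldType) (p m e : nat) (z : algC) (beta : F)
  : {poly algC} :=
  \prod_(i < e) ('X - (gperiod p m e z beta i)%:P).

Definition intC (x : int) : algC := x%:~R.

(* Main.v *)
(** The (-1)-composition is convolution on (Z/e)^2, so a two-dimensional discrete Fourier
    transform turns it into multiplication.  For e-th roots of unity x, y write G(x) for the
    Gauss sum of the character beta^k |-> x^k.  The relation
    eta(m) eta(m+i) = sum_j C(i,j) eta(m+j) says that the transform of C satisfies
    C^(x,y) G(1/y) = G(x) G(1/(xy)), and Gauss sums do not vanish.  By the Hasse-Davenport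
    relation G_{nr}(x) = (-1)^(n-1) G_r(x)^n, which gives
    C_{nr}^ = (-1)^(n-1) (C_r^)^n, and Fourier inversion finishes.

    Hasse-Davenport is obtained from the logarithmic derivative of the L-function of
    lam(X^k - c_1 X^(k-1) + ... + (-1)^k c_k) = psi(c_1) chi(c_k), written as a recurrence:
    deg f = sum over prime powers P^m | f of deg P, hence
    k a_k = sum_j s_j a_(k-j), where a_k sums lam over the monic polynomials of degree k and
    s_j = sum_(m deg P = j) deg P lam(P)^m.  Here a_0 = 1, a_1 = G_r, a_k = 0 for k >= 2, and
    s_n is the Gauss sum of the extension, since P has deg P roots there when deg P | n. *)
Require Import Defs.
From HB Require Import structures.
From mathcomp Require Import all_boot all_order all_algebra all_field.
From mathcomp Require Import zify ring.
Import GRing.Theory.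
Local Open Scope ring_scope.
Set Implicit Arguments. Unset Strict Implicit. Unset Printing Implicit Defensive.

(** * Degree and subleading coefficient of monic polynomials *)

Definition pdeg (R : nzSemiRingType) (f : {poly R}) : nat := (size f).-1.

(* The factor 'X makes the value 0, not the leading coefficient, for constant f. *)
Definition subtop (R : nzSemiRingType) (f : {poly R}) : R := ('X * f)`_(pdeg f).

Lemma monic_sizeE (R : nzSemiRingType) (f : {poly R}) :
  f \is monic -> size f = (pdeg f).+1.
Proof. by move=> fm; rewrite prednK // size_poly_gt0 monic_neq0. Qed.

Lemma pdegM (R : nzSemiRingType) (f g : {poly R}) :
  f \is monic -> g \is monic -> pdeg (f * g) = (pdeg f + pdeg g)%N.
Proof.
move=> fm gm; rewrite {1}/pdeg size_monicM ?monic_neq0 //.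
by rewrite !monic_sizeE // addSn addnS.
Qed.

Lemma pdeg_exp (R : nzSemiRingType) (f : {poly R}) m :
  f \is monic -> pdeg (f ^+ m) = (m * pdeg f)%N.
Proof.
move=> fm; elim: m => [|m IH]; first by rewrite /pdeg expr0 size_poly1.
by rewrite exprS pdegM ?monic_exp // IH mulSn.
Qed.

Lemma monic_pdeg0 (R : nzSemiRingType) (f : {poly R}) :
  f \is monic -> pdeg f = 0%N -> f = 1.
Proof.
move=> fm f0; have /size_poly1P[c _ fc] : size f == 1%N by rewrite monic_sizeE // f0.
by move: fm; rewrite fc monicE lead_coefC => /eqP->.
Qed.

Lemma subtop1 (R : nzSemiRingType) : subtop (1 : {poly R}) = 0.
Proof. by rewrite /subtop /pdeg size_poly1 mulr1 coefX. Qed.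

(** Up to sign this coefficient is the sum of the roots. In the convolution only [j = a] and
    [j = a.+1] can contribute; for any other [j] one of the two indices exceeds the degree. *)
Lemma subtopM (R : nzSemiRingType) (f g : {poly R}) :
  f \is monic -> g \is monic -> subtop (f * g) = subtop f + subtop g.
Proof.
move=> fm gm.
case Ef: (pdeg f) => [|a]; first by rewrite (monic_pdeg0 fm Ef) mul1r subtop1 add0r.
case Eg: (pdeg g) => [|b]; first by rewrite (monic_pdeg0 gm Eg) mulr1 subtop1 addr0.
rewrite /subtop !coefXM pdegM // Ef Eg /= addnS /=.
have fa : f`_a.+1 = 1 by move/monicP: (fm); rewrite /lead_coef -/(pdeg f) Ef.
have gb : g`_b.+1 = 1 by move/monicP: (gm); rewrite /lead_coef -/(pdeg g) Eg.
have f0 j : (a.+1 < j)%N -> f`_j = 0.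
  by move=> h; rewrite nth_default // monic_sizeE // Ef.
have g0 j : (b.+1 < j)%N -> g`_j = 0.
  by move=> h; rewrite nth_default // monic_sizeE // Eg.
have ha : (a < (a + b).+2)%N by rewrite ltnS -addnS leq_addr.
have ha' : (a.+1 < (a + b).+2)%N by rewrite !ltnS leq_addr.
rewrite coefM (bigD1 (Ordinal ha)) //= (bigD1 (Ordinal ha')) /=; last first.
  by rewrite -val_eqE /= eqn_leq ltnn.
rewrite big1 => [|j /andP[ja ja']].
  by rewrite addr0 fa mul1r -addnS addKn gb mulr1 addnS subSS addKn.
move: ja ja'; rewrite -!val_eqE /= => ja ja'.
case: (ltngtP j a.+1) => [|h|/eqP]; last 2 first.
- by rewrite f0 // mul0r.
- by rewrite (negPf ja').
rewrite ltnS leq_eqVlt (negPf ja) /= => h.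
by rewrite [g`__]g0 ?mulr0 //; lia.
Qed.

(** * Monic polynomials over a finite field *)

Section MonicCount.
Variable K : finFieldType.
Implicit Types (f g P Q : {poly K}) (k m n N d : nat).

Definition polys n : seq {poly K} :=
  map (val : {poly_n K} -> {poly K}) (enum {: {poly_n K}}).

Lemma polys_uniq n : uniq (polys n).
Proof. by rewrite map_inj_uniq ?enum_uniq //; apply: val_inj. Qed.

Lemma mem_polys n f : (f \in polys n) = (size f <= n)%N.
Proof.
apply/mapP/idP => [[g _ ->]|sf]; first exact: size_npoly.
by exists (NPoly (sf : f \is a poly_of_size n)); rewrite ?mem_enum.
Qed.

Definition monics k := [seq f <- polys k.+1 | (f \is monic) && (pdeg f == k)].

Lemma monics_uniq k : uniq (monics k).
Proof. by rewrite filter_uniq ?polys_uniq. Qed.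

Lemma mem_monics k f : (f \in monics k) = (f \is monic) && (pdeg f == k).
Proof.
rewrite mem_filter mem_polys; case: (boolP (f \is monic)) => //= fm.
by case: eqP => //= fk; rewrite monic_sizeE // fk leqnn.
Qed.

Definition mirr P := (P \is monic) && irreducibleb P.
Definition irrs N := [seq P <- polys N.+1 | mirr P].

Lemma irrs_uniq N : uniq (irrs N).
Proof. by rewrite filter_uniq ?polys_uniq. Qed.

Lemma mem_irrs N P : (P \in irrs N) = mirr P && (pdeg P <= N)%N.
Proof.
rewrite mem_filter mem_polys; case: (boolP (mirr P)) => //= /andP[Pm _].
by rewrite monic_sizeE.
Qed.

Lemma mirr_monic P : mirr P -> P \is monic. Proof. by case/andP. Qed.

Lemma mirr_pdeg_gt0 P : mirr P -> (0 < pdeg P)%N.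
Proof. by case/andP=> Pm /irreducibleP[]; rewrite monic_sizeE. Qed.

Lemma mirr_dvd_eq P Q : mirr P -> mirr Q -> P %| Q -> P = Q.
Proof.
move=> /andP[Pm /irreducibleP[sP _]] /andP[Qm /irreducibleP[_ hQ]] PQ.
apply/eqP; rewrite -eqp_monic //; apply: hQ => //.
by rewrite neq_ltn sP orbT.
Qed.

Lemma mirr_coprime P Q : mirr P -> mirr Q -> P != Q -> coprimep P Q.
Proof.
move=> Pi Qi; apply: contraR; case/andP: (Pi) => _ /irreducibleP Pi'.
by rewrite irreducible_poly_coprime // negbK => /mirr_dvd_eq->.
Qed.

Lemma mirr_factor f : (1 < size f)%N -> exists2 P, mirr P & P %| f.
Proof.
have [n] := ubnP (size f); elim: n f => // n IH f; rewrite ltnS => sf s1.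
case: (boolP (irreducibleb f)) => [/irreducibleP[_ hf]|].
  have f0 : f != 0 by rewrite -size_poly_gt0; apply: ltn_trans s1.
  have c0 : (lead_coef f)^-1 != 0 by rewrite invr_eq0 lead_coef_eq0.
  exists ((lead_coef f)^-1 *: f); last by rewrite dvdpZl.
  apply/andP; split; first by rewrite monicE lead_coefZ mulVf // lead_coef_eq0.
  apply/irreducibleP; split; first by rewrite size_scale.
  by move=> q sq; rewrite dvdpZr // => /(hf q sq) /eqp_trans->;
    rewrite // eqp_sym eqp_scale.
(* The boolean test ranges over polynomials of size below [size f], so the nonconstant divisor [q]
   it yields is strictly smaller and the induction applies. *)
rewrite /irreducibleb s1 /= negb_forall => /existsP[q].
rewrite negb_imply -ltnNge -Pdiv.Idomain.dvdpE => /andP[qf sq].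
have sqf : (size q < n)%N.
  by apply: leq_trans sf; apply: leq_ltn_trans (size_npoly q) _; case: (size f) s1.
have [P Pi Pq] := IH _ sqf sq.
by exists P => //; apply: dvdp_trans qf.
Qed.

(** The multiplicity of [P] in [f], counted by the exponents [m] for which [P ^+ m] divides [f]; for
    irreducible [P] the cut-off loses nothing once [N] is at least the degree of a nonzero [f]. *)
Definition pval N P f : nat := (\sum_(1 <= m < N.+1) (P ^+ m %| f)%R)%N.

Lemma pval1 N P : mirr P -> pval N P 1 = 0%N.
Proof.
move=> Pi; rewrite /pval big_nat big1 // => m /andP[m0 _].
have Pm := mirr_monic Pi.
have P0 := mirr_pdeg_gt0 Pi.
rewrite dvdp1 monic_sizeE ?monic_exp // pdeg_exp // eqSS.
by rewrite muln_eq0 2!eqn0Ngt m0 P0.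
Qed.

Lemma pvalM N P Q g : mirr P -> mirr Q -> g \is monic -> (pdeg (Q * g) <= N)%N ->
  pval N P (Q * g) = ((P == Q) + pval N P g)%N.
Proof.
move=> Pi Qi gm; have Pm := mirr_monic Pi; have Qm := mirr_monic Qi.
rewrite pdegM // => dN.
case: eqVneq => [PQ|PQ]; last first.
  rewrite /pval; apply: eq_bigr => m _; rewrite Gauss_dvdpr //.
  by rewrite coprimep_expl // mirr_coprime.
subst Q; rewrite /pval big_nat_recl; last first.
  by apply: leq_trans dN; rewrite addn_gt0 mirr_pdeg_gt0.
rewrite expr1 dvdp_mulr // add1n; congr _.+1.
under eq_bigr do rewrite exprS dvdp_mul2l ?monic_neq0 //.
case: N dN => [|N] dN; first by rewrite !big_geq.
(* The right-hand sum has one further term, for the exponent [N.+1]; it is 0 because [P ^+ N.+1] has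
   larger degree than [g]. *)
rewrite [RHS]big_nat_recr //= -[LHS]addn0; congr (_ + _)%N.
case: (boolP (_ %| _)) => // /(dvdp_leq (monic_neq0 gm)).
rewrite !monic_sizeE ?monic_exp // pdeg_exp // ltnS.
have := mirr_pdeg_gt0 Pi; move: dN => dN P0 h.
by have {h} : (N.+1 * pdeg P <= pdeg g)%N := h; nia.
Qed.

(* The analogue in K[X] of log n = sum_(d %| n) Lambda(d). *)
Lemma pdeg_sum_pval N f : f \is monic -> (pdeg f <= N)%N ->
  pdeg f = (\sum_(P <- irrs N) pval N P f * pdeg P)%N.
Proof.
have [n] := ubnP (pdeg f); elim: n f => // n IH f; rewrite ltnS => fn fm fN.
case E: (pdeg f) => [|k].
  rewrite (monic_pdeg0 fm E) big_seq big1 // => P.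
  by rewrite mem_irrs => /andP[Pi _]; rewrite pval1.
have [|Q Qi /dvdpP[g fg]] := @mirr_factor f; first by rewrite monic_sizeE // E.
have Qm := mirr_monic Qi.
have gm : g \is monic by rewrite -(monicMr _ Qm) -fg.
rewrite mulrC in fg; move: (E); rewrite fg pdegM // => Edeg.
have Q0 := mirr_pdeg_gt0 Qi.
have fE := fN; rewrite fg in fE.
rewrite -{1}Edeg (IH g) //; try lia.
rewrite big_seq [RHS]big_seq.
rewrite [RHS](eq_bigr (fun P => (P == Q) * pdeg P + pval N P g * pdeg P)%N); last first.
  move=> P; rewrite mem_irrs => /andP[Pi _].
  by rewrite pvalM // mulnDl.
rewrite big_split /= -!big_seq; congr (_ + _)%N.
rewrite (bigD1_seq Q) ?irrs_uniq //=; last by rewrite mem_irrs Qi; lia.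
by rewrite eqxx mul1n big1 ?addn0 // => P /negPf->.
Qed.

End MonicCount.

(** * Sums of multiplicative functions over monic polynomials *)

Section MonicSums.
Variables (K : finFieldType) (R : idomainType) (lam : {poly K} -> R).
Hypothesis lam1 : lam 1 = 1.
Hypothesis lamM : forall f g, f \is monic -> g \is monic -> lam (f * g) = lam f * lam g.
Implicit Types (f g P Q : {poly K}) (k m n N d : nat).

Definition monic_sum k : R := \sum_(f <- monics K k) lam f.

Lemma monic_sum0 : monic_sum 0 = 1.
Proof.
rewrite /monic_sum (perm_big [:: 1]) ?big_seq1 //.
apply: uniq_perm => //; first exact: monics_uniq.
move=> f; rewrite mem_monics inE; apply/andP/eqP => [[fm /eqP f0]|->].
  exact: monic_pdeg0.
by rewrite monic1 /pdeg size_poly1.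
Qed.

Lemma lam_exp f m : f \is monic -> lam (f ^+ m) = lam f ^+ m.
Proof.
move=> fm; elim: m => [|m IH]; first by rewrite !expr0.
by rewrite !exprS lamM ?monic_exp // IH.
Qed.

(** Division by [P] is a bijection from the multiples of [P] onto the monic polynomials of degree
    [k - pdeg P]. *)
Lemma monic_sum_multiples k P : P \is monic ->
  \sum_(f <- monics K k | P %| f) lam f =
    if (pdeg P <= k)%N then lam P * monic_sum (k - pdeg P) else 0.
Proof.
move=> Pm; case: leqP => kP; last first.
  rewrite big_seq_cond big1 // => f /andP[].
  rewrite mem_monics => /andP[fm /eqP fk] /(dvdp_leq (monic_neq0 fm)).
  by rewrite !monic_sizeE // ltnS fk leqNgt kP.
rewrite /monic_sum -big_filter (perm_big [seq P * g | g <- monics K (k - pdeg P)]).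
  rewrite big_map big_distrr /= big_seq [RHS]big_seq; apply: eq_bigr => g.
  by rewrite mem_monics => /andP[gm _]; rewrite lamM.
apply: uniq_perm; first by rewrite filter_uniq ?monics_uniq.
  by rewrite map_inj_uniq ?monics_uniq //; apply/mulfI/monic_neq0.
move=> f; rewrite mem_filter mem_monics; apply/and3P/mapP => [[]|[g]].
  move=> /dvdpP[g]; rewrite mulrC => -> gm /eqP fk; exists g => //.
  rewrite (monicMl _ Pm) in gm; rewrite mem_monics gm.
  by rewrite -fk pdegM // addKn /=.
rewrite mem_monics => /andP[gm /eqP gk] ->.
by rewrite dvdp_mulr // (monicMl _ Pm) gm pdegM // gk subnKC.
Qed.

(** Weight each [lam f] by the degree of [f], expand that degree over the prime powers dividing [f],
    and exchange the sums; what remains are sums over the multiples of [P ^+ m]. *)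
Lemma monic_sum_log N k : (k <= N)%N ->
  monic_sum k *+ k = \sum_(P <- irrs K N) \sum_(1 <= m < N.+1 | (m * pdeg P <= k)%N)
    (lam P ^+ m * monic_sum (k - m * pdeg P)) *+ pdeg P.
Proof.
move=> kN; rewrite /monic_sum -sumrMnl.
transitivity (\sum_(f <- monics K k) \sum_(P <- irrs K N) \sum_(1 <= m < N.+1 | P ^+ m %| f)
   lam f *+ pdeg P).
  rewrite big_seq [RHS]big_seq; apply: eq_bigr => f.
  rewrite mem_monics => /andP[fm /eqP fk].
  rewrite -{1}fk (@pdeg_sum_pval _ N) ?fk // -sumrMnr; apply: eq_bigr => P _.
  rewrite [RHS]big_mkcond /pval big_distrl /= -sumrMnr; apply: eq_bigr => m _.
  by case: ifP; rewrite ?mul1n.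
rewrite exchange_big /= big_seq [RHS]big_seq; apply: eq_bigr => P.
rewrite mem_irrs => /andP[/mirr_monic Pm _].
under eq_bigr do rewrite big_mkcond.
rewrite exchange_big [RHS]big_mkcond /=; apply: eq_bigr => m _.
rewrite -big_mkcond sumrMnl monic_sum_multiples ?monic_exp //.
rewrite pdeg_exp // lam_exp //; case: ifP => //; rewrite mul0rn //.
Qed.

(** The power sum attached to the Euler product of [lam]. For [1 <= k <= N] the cut-off at [N]
    removes nothing, since [m * pdeg P = k] bounds both factors by [k]. *)
Definition prime_power_sum N k : R :=
  \sum_(P <- irrs K N) \sum_(1 <= m < N.+1 | (m * pdeg P == k)%N) lam P ^+ m *+ pdeg P.

Hypothesis monic_sum_ge2 : forall k, (2 <= k)%N -> monic_sum k = 0.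

(** In [monic_sum_log] the factor [monic_sum (k.+1 - m * pdeg P)] vanishes unless the difference is
    0 or 1, which leaves two power sums. *)
Lemma prime_power_sum_rec N k : (k < N)%N ->
  monic_sum k.+1 *+ k.+1 = prime_power_sum N k.+1 + prime_power_sum N k * monic_sum 1.
Proof.
move=> kN; rewrite (monic_sum_log kN) /prime_power_sum big_distrl -big_split /=.
apply: eq_bigr => P _; rewrite big_distrl !(big_mkcond (fun m => _ <= _)%N).
rewrite !(big_mkcond (fun m => _ == _)) -big_split /=; apply: eq_bigr => m _.
have [h|h|h] := ltngtP (m * pdeg P)%N k.+1.
- have [->|h'] := eqVneq (m * pdeg P)%N k.
    by rewrite subSnn add0r mulrnAl.
  by rewrite monic_sum_ge2 ?mulr0 ?mul0rn ?addr0 //; lia.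
- have -> : (m * pdeg P == k)%N = false by apply/eqP; lia.
  by rewrite addr0.
- have -> : (m * pdeg P == k)%N = false by apply/eqP; lia.
  by rewrite h subnn monic_sum0 mulr1 addr0.
Qed.

(** The recurrence starts from [prime_power_sum N 0 = 0], as irreducibles have positive degree and
    exponents start at 1. From degree 2 on its left side vanishes, so each step multiplies by
    [- monic_sum 1]. *)
Lemma prime_power_sumE N k : (k < N)%N ->
  prime_power_sum N k.+1 = (-1) ^+ k * monic_sum 1 ^+ k.+1.
Proof.
elim: k => [|k IH] kN; have := prime_power_sum_rec kN.
  rewrite mulr1n mul1r expr1 => ->.
  rewrite [prime_power_sum N 0]big_seq big1 ?mul0r ?addr0 // => P.
  rewrite mem_irrs => /andP[/mirr_pdeg_gt0 P0 _].
  by rewrite big_nat_cond big1 // => m; lia.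
rewrite monic_sum_ge2 // mul0rn IH; last exact: ltnW.
move/eqP; rewrite eq_sym addr_eq0 => /eqP->.
by rewrite [in RHS]exprS mulN1r mulNr -mulrA -exprSr.
Qed.

End MonicSums.

(** * The Hasse-Davenport relation *)

Section GaussMonic.
Variables (K : finFieldType) (R : idomainType) (psi chi : K -> R) (t : K).
Hypothesis psi0 : psi 0 = 1.
Hypothesis psiD : forall x y, psi (x + y) = psi x * psi y.
Hypothesis psit : psi t != 1.
Hypothesis chi1 : chi 1 = 1.
Hypothesis chiM : forall x y, chi (x * y) = chi x * chi y.
Implicit Types f g : {poly K}.

(* psi(c_1) chi(c_k) for f = X^k - c_1 X^(k-1) + ... + (-1)^k c_k. *)
Definition gauss_weight f : R := psi (- subtop f) * chi ((-1) ^+ pdeg f * f`_0).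

Lemma gauss_weight1 : gauss_weight 1 = 1.
Proof.
by rewrite /gauss_weight subtop1 oppr0 psi0 mul1r /pdeg size_poly1 coef1 mulr1 chi1.
Qed.

Lemma gauss_weightM f g : f \is monic -> g \is monic ->
  gauss_weight (f * g) = gauss_weight f * gauss_weight g.
Proof.
move=> fm gm; rewrite /gauss_weight subtopM // opprD psiD pdegM // exprD.
by rewrite coef0M mulrACA chiM mulrACA.
Qed.

(** The monic polynomials of degree 1 are the ['X - x%:P], each of weight [psi x * chi x]; thus the
    linear coefficient of the L-function is the Gauss sum. *)
Lemma gauss_weight_sum1 : monic_sum gauss_weight 1 = \sum_x psi x * chi x.
Proof.
rewrite /monic_sum (perm_big [seq 'X - x%:P | x <- enum K]).
  rewrite big_map big_enum; apply: eq_bigr => x _.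
  rewrite /gauss_weight /subtop /pdeg size_XsubC /= coefXM /= coefB coefX coefC /=.
  by rewrite sub0r opprK expr1 mulN1r opprK.
apply: uniq_perm; first exact: monics_uniq.
  rewrite map_inj_uniq ?enum_uniq // => x y /addrI /oppr_inj; exact: polyC_inj.
move=> f; rewrite mem_monics; apply/andP/mapP => [[fm /eqP f1]|[x _ ->]].
  exists (- f`_0); rewrite ?mem_enum //.
  apply/polyP => i; rewrite coefB coefX coefC.
  case: i => [|[|i]] /=; first by rewrite sub0r opprK.
    by rewrite subr0; move/monicP: fm; rewrite /lead_coef -/(pdeg f) f1.
  by rewrite subr0 nth_default // monic_sizeE // f1.
by rewrite monicXsubC /pdeg size_XsubC.
Qed.

(* Translating the coefficient of X^(k-1) by t multiplies the sum by psi(t) <> 1. *)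
Lemma gauss_weight_sum_ge2 k : (2 <= k)%N -> monic_sum gauss_weight k = 0.
Proof.
move=> k2; pose T f := f - t *: 'X^(k.-1).
have szX f : f \is monic -> pdeg f = k -> (size (- (t *: 'X^(k.-1)))%R < size f)%N.
  move=> fm fk; rewrite size_polyN (leq_ltn_trans (size_scale_leq _ _)) //.
  by rewrite size_polyXn monic_sizeE // fk; lia.
have Tm f : f \is monic -> pdeg f = k -> T f \is monic /\ pdeg (T f) = k.
  move=> fm fk; split; last by rewrite /pdeg size_polyDl ?szX.
  by rewrite monicE lead_coefDl ?szX // -monicE.
have Tw f : f \is monic -> pdeg f = k -> gauss_weight (T f) = psi t * gauss_weight f.
  move=> fm fk; have [_ dT] := Tm f fm fk.
  have c0 : (T f)`_0 = f`_0.
    rewrite coefB coefZ coefXn.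
    by case: k k2 {szX Tm dT T fk} => [|[|k]] //=; rewrite mulr0 subr0.
  rewrite /gauss_weight c0 /subtop dT fk !coefXM coefB coefZ coefXn eqxx mulr1.
  have -> : (k == 0)%N = false by lia.
  by rewrite opprB psiD mulrA.
apply/eqP; have: (1 - psi t) * monic_sum gauss_weight k == 0.
  rewrite mulrBl mul1r subr_eq0 {1}/monic_sum (perm_big (map T (monics K k))).
    rewrite big_map /monic_sum big_distrr /= big_seq [X in _ == X]big_seq.
    apply/eqP; apply: eq_bigr => f; rewrite mem_monics => /andP[fm /eqP fk].
    exact: Tw.
  have Tu : uniq (map T (monics K k)).
    by rewrite map_inj_uniq ?monics_uniq // => f g /addIr.
  have Ts : {subset map T (monics K k) <= monics K k}.
    move=> h /mapP[f]; rewrite mem_monics => /andP[fm /eqP fk] ->.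
    by have [Tfm dT] := Tm f fm fk; rewrite mem_monics Tfm dT eqxx.
  (* An injective self-map of a finite set is onto, so [T] permutes [monics K k]. *)
  have [_ Te] := uniq_min_size Tu Ts (eq_leq (esym (size_map _ _))).
  by apply: uniq_perm => //; exact: monics_uniq.
by rewrite mulf_eq0 subr_eq0 eq_sym (negPf psit).
Qed.

End GaussMonic.

(** * Irreducible factors and their roots *)

Lemma mirr_root_factor (K : finFieldType) (L : fieldType) (emb : {rmorphism K -> L})
    (f : {poly K}) (x : L) :
  f != 0 -> root (map_poly emb f) x ->
  exists P, [/\ mirr P, P %| f & root (map_poly emb P) x].
Proof.
have [n] := ubnP (size f); elim: n f => // n IH f; rewrite ltnS => sf f0 fx.
have sf1 : (1 < size f)%N.
  rewrite ltnNge; apply/negP => /size1_polyC fC; move: fx f0.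
  by rewrite fC map_polyC rootC fmorph_eq0 polyC_eq0 => ->.
have [P Pi /dvdpP[g fg]] := mirr_factor sf1.
have P0 := monic_neq0 (mirr_monic Pi).
move: fx; rewrite fg rmorphM rootM => /orP[gx|Px]; last by exists P; rewrite dvdp_mull.
have g0 : g != 0 by apply: contraNneq f0 => g0; rewrite fg g0 mul0r.
have [|Q [Qi Qg Qx]] := IH g _ g0 gx.
  apply: leq_trans sf; rewrite fg mulrC size_monicM ?mirr_monic //.
  have := mirr_pdeg_gt0 Pi; rewrite (monic_sizeE (mirr_monic Pi)).
  have : (0 < size g)%N by rewrite size_poly_gt0.
  lia.
by exists Q; rewrite Qi Qx dvdp_mulr.
Qed.

Lemma mirr_powerP (K : finFieldType) (f P : {poly K}) :
  f \is monic -> (forall Q, mirr Q -> Q %| f -> Q = P) -> exists m, f = P ^+ m.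
Proof.
have [n] := ubnP (size f); elim: n f => // n IH f; rewrite ltnS => sf fm hf.
case: (ltnP 1 (size f)) => sf1; last first.
  by exists 0%N; apply: monic_pdeg0; rewrite // /pdeg; lia.
have [Q Qi Qf] := mirr_factor sf1.
have QP := hf Q Qi Qf; rewrite {Q}QP in Qi Qf.
have Pm := mirr_monic Qi.
case/dvdpP: Qf => g fg; have gm : g \is monic by rewrite -(monicMr _ Pm) -fg.
have [||m gE] := IH g _ gm; first 2 last.
- by exists m.+1; rewrite fg gE exprSr.
- apply: leq_trans sf; rewrite fg mulrC size_monicM ?monic_neq0 //.
  have := mirr_pdeg_gt0 Qi; rewrite (monic_sizeE Pm) (monic_sizeE gm).
  by lia.
by move=> Q Qj Qg; apply: hf => //; rewrite fg dvdp_mulr.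
Qed.

(* X^(q^d) = X in the field K[X]/(P) with q^d elements. *)
Lemma mirr_dvd_XqX (K : finFieldType) (P : {poly K}) n :
  mirr P -> (pdeg P %| n)%N -> P %| 'X^(#|K| ^ n) - 'X.
Proof.
move=> /andP[Pm /irreducibleP Pi] /dvdnP[k ->].
pose hP : monic_irreducible_poly P := (Pi, Pm).
pose F : finFieldType := {poly %/ P with hP}.
have cF : #|F| = (#|K| ^ pdeg P)%N by rewrite card_qfpoly.
have fX (y : F) : y ^+ (#|K| ^ (k * pdeg P)) = y.
  elim: k => [|k IH]; first by rewrite mul0n expn0 expr1.
  by rewrite mulSn expnD -cF exprM expf_card.
set N := (_ ^ _)%N; have : in_qpoly P ('X^N - 'X) = 0.
  by rewrite rmorphB rmorphXn /= -[X in X - _]/((in_qpoly P 'X : F) ^+ N) fX subrr.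
move/val_eqP => /=; rewrite -Pdiv.IdomainMonic.modpE ?mk_monicE //.
Qed.

(** * Characteristic polynomials, trace and norm in an extension of finite fields *)

Section NormTrace.
Variables (K L : finFieldType) (emb : {rmorphism K -> L}) (n : nat).
Hypothesis n_gt0 : (0 < n)%N.
Hypothesis cardL : #|L| = (#|K| ^ n)%N.
Hypothesis pcharLK : [pchar L].-nat #|K|.
Local Notation q := #|K|.

(** The Frobenius of [L] over [K]. It is additive because [#|K|] is a power of the characteristic,
    and is made a ring morphism so that it can act on coefficients. *)
Definition qfrob (x : L) : L := x ^+ q.

Fact qfrob_nmod_morphism : nmod_morphism qfrob.
Proof.
split=> [|x y]; rewrite /qfrob ?exprDn_pchar // expr0n.
by rewrite eqn0Ngt (ltnW (finNzRing_gt1 K)).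
Qed.

Fact qfrob_monoid_morphism : monoid_morphism qfrob.
Proof. by split=> [|x y]; rewrite /qfrob ?expr1n ?exprMn. Qed.

HB.instance Definition _ := GRing.isNmodMorphism.Build L L qfrob qfrob_nmod_morphism.
HB.instance Definition _ := GRing.isMonoidMorphism.Build L L qfrob qfrob_monoid_morphism.

(** Over [K] the polynomial ['X^q - 'X] is the product of all ['X - u%:P], so its roots in [L] are
    the images of elements of [K]. *)
Lemma qfrob_fixed y : y ^+ q = y -> exists u, emb u = y.
Proof.
move=> yq; have : (map_poly emb ('X^q - 'X)).[y] = 0.
  by rewrite rmorphB /= map_polyXn map_polyX !hornerE yq subrr.
rewrite finField_genPoly rmorph_prod horner_prod => /eqP /prodf_eq0[u _].
rewrite /= map_polyXsubC hornerXsubC subr_eq0 => /eqP yu; by exists u.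
Qed.

(** A left inverse of [emb], with default value 0 outside its image. *)
Definition descend (y : L) : K := odflt 0 [pick u | emb u == y].

Lemma descendK y : y ^+ q = y -> emb (descend y) = y.
Proof.
move=> /qfrob_fixed[u yu]; rewrite /descend; case: pickP => [v /eqP // | /(_ u)].
by rewrite yu eqxx.
Qed.

Lemma emb_descend u : descend (emb u) = u.
Proof. by apply: (fmorph_inj emb); rewrite descendK // -rmorphXn expf_card. Qed.

(** Conjugates are listed with repetition, so this is the characteristic polynomial of [x] over [K],
    of degree [n] even when [x] lies in a proper subfield. *)
Definition conj_poly (x : L) : {poly L} :=
  \prod_(y <- [seq x ^+ (q ^ i) | i <- iota 0 n]) ('X - y%:P).

Definition descend_poly (x : L) : {poly K} := map_poly descend (conj_poly x).

(** The Frobenius permutes the list of conjugates cyclically, since [x ^+ (q ^ n) = x]. Its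
    coefficients therefore come from [K]. *)
Lemma conj_poly_qfrob x : map_poly qfrob (conj_poly x) = conj_poly x.
Proof.
rewrite /conj_poly rmorph_prod big_map [RHS]big_map.
under eq_bigr do rewrite /= map_polyXsubC /= /qfrob -exprM -expnSr.
rewrite -!/(index_iota 0 n) -(subn0 n) -/(index_iota 0 n) -(prednK n_gt0).
rewrite [RHS]big_nat_recl // [LHS]big_nat_recr //= mulrC prednK //.
by rewrite -cardL expf_card expn0 expr1.
Qed.

Lemma descend_polyK x : map_poly emb (descend_poly x) = conj_poly x.
Proof.
have d0 : descend 0 = 0 by rewrite -[0 in LHS](rmorph0 emb) emb_descend.
apply/polyP => i; rewrite coef_map /= coef_map_id0 // descendK //.
by rewrite -[in RHS]conj_poly_qfrob coef_map.
Qed.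

Lemma descend_poly_monic x : descend_poly x \is monic.
Proof. by rewrite -(map_monic emb) descend_polyK monic_prod_XsubC. Qed.

Lemma pdeg_descend_poly x : pdeg (descend_poly x) = n.
Proof.
by rewrite /pdeg -(size_map_poly emb) descend_polyK size_prod_XsubC size_map size_iota.
Qed.

Lemma root_conj_poly x y : root (conj_poly x) y = [exists i : 'I_n, y == x ^+ (q ^ i)].
Proof.
rewrite root_prod_XsubC; apply/mapP/existsP => [[i]|[i /eqP ->]].
  by rewrite mem_iota /= => iln ->; exists (Ordinal iln).
by exists (i : nat); rewrite // mem_iota ltn_ord.
Qed.

Lemma root_descend_poly x : root (map_poly emb (descend_poly x)) x.
Proof.
rewrite descend_polyK root_conj_poly; apply/existsP; exists (Ordinal n_gt0).
by rewrite expn0 expr1.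
Qed.

Lemma root_qfrob_exp (P : {poly K}) x i :
  root (map_poly emb P) x -> root (map_poly emb P) (x ^+ (q ^ i)).
Proof.
move=> Px; elim: i => [|i IH]; first by rewrite expn0 expr1.
rewrite expnSr exprM -/(qfrob _).
have -> : map_poly emb P = map_poly qfrob (map_poly emb P).
  by apply/polyP => j; rewrite !coef_map /= /qfrob -rmorphXn expf_card.
by rewrite /root horner_map (eqP IH) rmorph0.
Qed.

Lemma mirr_common_root (P Q : {poly K}) x : mirr P -> mirr Q ->
  root (map_poly emb P) x -> root (map_poly emb Q) x -> P = Q.
Proof.
move=> Pi Qi Px Qx; apply/eqP; apply: contraLR Qx => PQ.
by apply: coprimep_root Px; rewrite coprimep_map mirr_coprime.
Qed.

(** Over [L] an irreducible factor [Q] is, up to a unit, a nonempty subproduct of the linear factors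
    at conjugates of [x]. Such a conjugate is a root of [P] too, and distinct monic irreducibles
    have no common root. *)
Lemma descend_poly_power (P : {poly K}) x : mirr P -> root (map_poly emb P) x ->
  exists m, descend_poly x = P ^+ m.
Proof.
move=> Pi Px; apply: mirr_powerP => [|Q Qi]; first exact: descend_poly_monic.
rewrite -(dvdp_map emb) descend_polyK => /dvdp_prod_XsubC[b].
case E: (mask b _) => [|y s].
  rewrite big_nil => Q1; have := eqp_size Q1.
  rewrite size_map_poly size_poly1 (monic_sizeE (mirr_monic Qi)) => -[/eqP].
  by rewrite -leqn0 leqNgt mirr_pdeg_gt0.
move=> QE; have Qy : root (map_poly emb Q) y.
  by rewrite (eqp_root QE) root_prod_XsubC inE eqxx.
have : y \in [seq x ^+ (q ^ i) | i <- iota 0 n].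
  by apply: (@mem_mask _ _ b); rewrite E inE eqxx.
case/mapP => i _ yE; apply: (mirr_common_root Qi Pi Qy).
by rewrite yE; exact: root_qfrob_exp.
Qed.

(** [P] divides ['X^(#|L|) - 'X], which splits over [L] into distinct linear factors. *)
Lemma card_roots_mirr (P : {poly K}) : mirr P -> (pdeg P %| n)%N ->
  #|[pred x | root (map_poly emb P) x]| = pdeg P.
Proof.
move=> Pi Pn; have := mirr_dvd_XqX Pi Pn.
rewrite -cardL -(dvdp_map emb) rmorphB /= map_polyXn map_polyX finField_genPoly.
rewrite -big_enum => /dvdp_prod_XsubC[b PE].
have Pm := mirr_monic Pi.
rewrite /pdeg -(size_map_poly emb) (eqp_size PE) size_prod_XsubC /=.
rewrite -(card_uniqP (mask_uniq (enum_uniq L) b)).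
by apply: eq_card => x; rewrite inE (eqp_root PE) root_prod_XsubC.
Qed.

(** The witness is the minimal polynomial of [x]; its degree is at most [n] because it divides
    [descend_poly x]. *)
Lemma root_descend_unique x :
  exists2 P, P \in irrs K n & forall Q, Q \in irrs K n ->
    root (map_poly emb Q) x = (Q == P).
Proof.
have m0 := monic_neq0 (descend_poly_monic x).
have [P [Pi Pd Px]] := mirr_root_factor m0 (root_descend_poly x).
exists P => [|Q].
  rewrite mem_irrs Pi -(pdeg_descend_poly x) -ltnS.
  rewrite -!monic_sizeE ?descend_poly_monic ?mirr_monic //.
  exact: dvdp_leq.
rewrite mem_irrs => /andP[Qi _]; apply/idP/eqP => [Qx|->//].
exact: mirr_common_root Px.
Qed.

(** Group the elements of [L] by minimal polynomial [P]. If [n = k * pdeg P], there are [pdeg P]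
    such elements, each with characteristic polynomial [P ^+ k]; if [pdeg P] does not divide [n],
    both sides contribute 0. *)
Lemma prime_power_sum_roots (R : idomainType) (lam : {poly K} -> R) :
  lam 1 = 1 ->
  (forall f g, f \is monic -> g \is monic -> lam (f * g) = lam f * lam g) ->
  prime_power_sum lam n n = \sum_x lam (descend_poly x).
Proof.
move=> lam1 lamM; transitivity
    (\sum_x \sum_(P <- irrs K n | root (map_poly emb P) x) lam (descend_poly x)); last first.
  apply: eq_bigr => x _; have [P Pn hP] := root_descend_unique x.
  rewrite -big_filter (perm_big [:: P]) ?big_seq1 //.
  apply: uniq_perm => //; first exact: (filter_uniq _ (irrs_uniq K n)).
  move=> Q.
  rewrite mem_filter inE; apply/andP/eqP => [[Qx Qn]|->]; last by rewrite hP.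
  by apply/eqP; rewrite -hP.
under [RHS]eq_bigr do rewrite big_mkcond.
rewrite exchange_big /= /prime_power_sum big_seq [RHS]big_seq; apply: eq_bigr => P.
rewrite mem_irrs => /andP[Pi _]; rewrite -[RHS]big_mkcond /=.
have Pm := mirr_monic Pi; have P0 := mirr_pdeg_gt0 Pi.
have mP x : root (map_poly emb P) x ->
    exists2 m, (m * pdeg P)%N = n & descend_poly x = P ^+ m.
  move=> /(descend_poly_power Pi)[m xm]; exists m => //.
  by rewrite -pdeg_exp // -xm pdeg_descend_poly.
case: (boolP (pdeg P %| n)%N) => [/dvdnP[k nk]|Pn]; last first.
  rewrite [RHS]big1 ?big1 // => [m /eqP mn|x /mP[m mn _]]; case/negP: Pn;
    by rewrite -mn dvdn_mull.
rewrite [RHS](eq_bigr (fun _ => lam P ^+ k)) => [|x /mP[m mn ->]]; last first.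
  rewrite lam_exp //; congr (_ ^+ _); apply/eqP.
  by rewrite -(eqn_pmul2r P0) mn nk.
rewrite sumr_const card_roots_mirr ?nk ?dvdn_mull //.
rewrite (eq_bigl (pred1 k)) => [|m]; last by rewrite /= eqn_pmul2r.
rewrite -big_filter filter_pred1_uniq ?iota_uniq ?big_seq1 //.
rewrite mem_index_iota -nk; move: n_gt0; rewrite nk; nia.
Qed.

(** Trace and norm are read off the characteristic polynomial with the signs of [gauss_weight], so
    that the weight of [descend_poly x] is [psi] of the trace times [chi] of the norm. *)
Definition rel_trace (x : L) : K := - subtop (descend_poly x).
Definition rel_norm (x : L) : K := (-1) ^+ n * (descend_poly x)`_0.

Lemma emb_rel_trace x : emb (rel_trace x) = \sum_(i < n) x ^+ (q ^ i).
Proof.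
rewrite /rel_trace /subtop pdeg_descend_poly coefXM eqn0Ngt n_gt0 /=.
rewrite rmorphN -coef_map descend_polyK.
have := @coefPn_prod_XsubC _ [seq x ^+ (q ^ i) | i <- iota 0 n].
rewrite size_map size_iota -lt0n => -> //.
by rewrite opprK big_map -{1}(subn0 n) big_mkord.
Qed.

Lemma emb_rel_norm x : emb (rel_norm x) = ffnorm K n x.
Proof.
rewrite /rel_norm rmorphM rmorphXn rmorphN1 -coef_map descend_polyK.
rewrite coef0_prod_XsubC size_map size_iota signrMK big_map.
by rewrite -{1}(subn0 n) big_mkord.
Qed.

(** Two evaluations of [prime_power_sum] at [n] are compared: by elements of [L], and by the
    recurrence. *)
Theorem hasse_davenport (R : idomainType) (psi chi : K -> R) (t : K) :
  psi 0 = 1 -> {morph psi : x y / x + y >-> x * y} -> psi t != 1 ->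
  chi 1 = 1 -> {morph chi : x y / x * y} ->
  \sum_x psi (rel_trace x) * chi (rel_norm x) =
    (-1) ^+ n.-1 * (\sum_x psi x * chi x) ^+ n.
Proof.
move=> psi0 psiD psit chi1 chiM.
have w1 := gauss_weight1 psi0 chi1; have wM := gauss_weightM psiD chiM.
rewrite -(gauss_weight_sum1 psi chi).
have := @prime_power_sumE _ _ _ w1 wM (gauss_weight_sum_ge2 chi psiD psit) n n.-1.
rewrite prednK // => <- //; rewrite (prime_power_sum_roots w1 wM).
by apply: eq_bigr => x _; rewrite /gauss_weight pdeg_descend_poly.
Qed.

End NormTrace.

(** * Fourier transform of the (-1)-composition *)

(** A polynomial of size at most [e] that vanishes at the [e] distinct powers of [w] is zero:
    injectivity of the discrete Fourier transform. *)
Lemma unity_coef_eq0 (R : fieldType) e (w : R) (c : 'I_e -> R) :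
  e.-primitive_root w -> (forall x, x ^+ e = 1 -> \sum_(i < e) c i * x ^+ i = 0) ->
  forall i, c i = 0.
Proof.
move=> wP hc; pose p := rVpoly (\row_i c i).
have sp : (size p <= e)%N by apply: size_poly.
have pE (i : 'I_e) : p`_i = c i by rewrite coef_rVpoly_ord mxE.
suff p0 : p = 0 by move=> i; rewrite -pE p0 coef0.
move: (sp); apply: contraTeq => p0; rewrite -ltnNge.
rewrite -[X in (X < _)%N](size_iota 0 e) -(size_map (GRing.exp w)).
apply: max_poly_roots => //.
  apply/allP => _ /mapP[k _ ->]; rewrite /root (horner_coef_wide _ sp).
  under eq_bigr do rewrite pE.
  by rewrite hc // exprAC (prim_expr_order wP) expr1n.
rewrite map_inj_in_uniq ?iota_uniq // => i j; rewrite !mem_iota /= => ie je /eqP.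
by rewrite (eq_prim_root_expr wP) !modn_small // => /eqP.
Qed.

Lemma expr_root (R : pzRingType) e (x : R) i j :
  x ^+ e = 1 -> i = j %[mod e] -> x ^+ i = x ^+ j.
Proof. by move=> xe ij; rewrite -(expr_mod i xe) ij expr_mod. Qed.

Definition mx_fourier (R : pzRingType) e (A : 'M[int]_e) (x y : R) : R :=
  \sum_(i < e) \sum_(j < e) (A i j)%:~R * x ^+ i * y ^+ j.

Lemma mx_fourier_inj (R : numFieldType) e (w : R) (A B : 'M[int]_e) :
  e.-primitive_root w ->
  (forall x y : R, x ^+ e = 1 -> y ^+ e = 1 -> mx_fourier A x y = mx_fourier B x y) ->
  A = B.
Proof.
move=> wP hAB; apply/matrixP => i j; apply/eqP; rewrite -(eqr_int R) -subr_eq0 -rmorphB.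
apply/eqP; move: j.
apply: (unity_coef_eq0 (c := fun j => (A i j - B i j)%:~R) wP) => y ye; move: i.
apply: (unity_coef_eq0 wP) => x xe.
transitivity (mx_fourier A x y - mx_fourier B x y); last by rewrite hAB // subrr.
rewrite /mx_fourier -sumrB.
apply: eq_bigr => i _; rewrite -sumrB big_distrl /=. apply: eq_bigr => j _.
by rewrite rmorphB /= !mulrBl mulrAC [in X in _ - X]mulrAC.
Qed.

Lemma modIE e (k : int) (i0 : 'I_e) : (modI k i0 : nat)%:Z = (k %% e)%Z.
Proof.
rewrite /= gez0_abs // modz_ge0 // -lt0n; exact: leq_ltn_trans (leq0n _) (ltn_ord i0).
Qed.

Lemma modI_shift e s (i : 'I_e) : modI (-1 * s%:Z + (i : nat)%:Z) i + s = i %[mod e].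
Proof.
apply/eqP; rewrite -eqz_nat -!modz_nat PoszD modIE modzDml.
by apply/eqP; congr (_ %% _)%Z; ring.
Qed.

Lemma modI_shift_inj e s : injective (fun i : 'I_e => modI (-1 * s%:Z + (i : nat)%:Z) i).
Proof.
move=> i j ij; have := modI_shift s j; rewrite -ij modI_shift !modn_small //.
exact: val_inj.
Qed.

Lemma sum_modI_shift (R : comPzRingType) e s (g : 'I_e -> R) x : x ^+ e = 1 ->
  \sum_(i < e) g (modI (-1 * s%:Z + (i : nat)%:Z) i) * x ^+ i =
  x ^+ s * \sum_(i < e) g i * x ^+ i.
Proof.
move=> xe; rewrite [in RHS](reindex_inj (@modI_shift_inj e s)) big_distrr /=.
apply: eq_bigr => i _; rewrite -(expr_root xe (modI_shift s i)) exprD.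
by rewrite [RHS]mulrC -mulrA.
Qed.

Lemma mx_fourier_dcomp (R : comPzRingType) e (A B : 'M[int]_e) (x y : R) :
  x ^+ e = 1 -> y ^+ e = 1 ->
  mx_fourier (dcomp (-1) A B) x y = mx_fourier A x y * mx_fourier B x y.
Proof.
(* [Bhat] is the transform of [B] in its second index alone, so that the shift rule can be applied
   one index at a time. *)
move=> xe ye; pose Bhat i := \sum_(j < e) (B i j)%:~R * y ^+ j.
have BhatE : mx_fourier B x y = \sum_(i < e) Bhat i * x ^+ i.
  by apply: eq_bigr => i _; rewrite big_distrl; apply: eq_bigr => j _; rewrite mulrAC.
transitivity (\sum_(i < e) \sum_(j < e) \sum_(s < e) \sum_(t < e)
   (A s t)%:~R * (B (modI (-1 * (s : nat)%:Z + (i : nat)%:Z) i)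
                    (modI (-1 * (t : nat)%:Z + (j : nat)%:Z) j))%:~R * x ^+ i * y ^+ j).
  apply: eq_bigr => i _; apply: eq_bigr => j _.
  rewrite mxE rmorph_sum !big_distrl; apply: eq_bigr => s _ /=.
  by rewrite rmorph_sum !big_distrl; apply: eq_bigr => t _ /=; rewrite rmorphM.
under eq_bigr do rewrite exchange_big.
rewrite exchange_big {1}/mx_fourier big_distrl; apply: eq_bigr => s _ /=.
under eq_bigr do rewrite exchange_big.
rewrite exchange_big big_distrl; apply: eq_bigr => t _ /=.
transitivity ((A s t)%:~R * (x ^+ s * \sum_(i < e) (y ^+ t * Bhat i) * x ^+ i)).
  rewrite -sum_modI_shift // big_distrr; apply: eq_bigr => i _ /=.
  rewrite /Bhat -sum_modI_shift // big_distrl big_distrr; apply: eq_bigr => j _ /=.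
  by rewrite -!mulrA [x ^+ i * _]mulrC.
rewrite BhatE -!mulrA; congr (_ * (_ * _)).
by rewrite big_distrr; apply: eq_bigr => i _ /=; rewrite mulrA.
Qed.

Lemma mx_fourier_dcomp_pow (R : comPzRingType) e n (A : 'M[int]_e) (x y : R) :
  (0 < n)%N -> x ^+ e = 1 -> y ^+ e = 1 ->
  mx_fourier (dcomp_pow A n) x y = mx_fourier A x y ^+ n.
Proof.
case: n => // n _ xe ye; rewrite /dcomp_pow /=; elim: n => [|n IH] //=.
by rewrite mx_fourier_dcomp // IH -exprSr.
Qed.

Lemma mx_fourierZ (R : comPzRingType) e a (A : 'M[int]_e) (x y : R) :
  mx_fourier (a *: A) x y = a%:~R * mx_fourier A x y.
Proof.
rewrite /mx_fourier big_distrr; apply: eq_bigr => i _ /=.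
rewrite big_distrr; apply: eq_bigr => j _ /=.
by rewrite mxE rmorphM /= !mulrA.
Qed.

(** * Gaussian periods and cyclotomic numbers *)

Section Cyclotomy.
Variables (F : finFieldType) (e : nat) (beta : F).
Hypothesis e_gt0 : (0 < e)%N.
Hypothesis e_dvd : (e %| #|F|.-1)%N.
Hypothesis beta_gen : is_generator beta.
Local Notation f := (fpart F e).

Lemma fpartK : (e * f)%N = #|F|.-1.
Proof. by rewrite mulnC divnK. Qed.

Lemma pred_card_gt0 : (0 < #|F|.-1)%N.
Proof. by rewrite -subn1 subn_gt0 finNzRing_gt1. Qed.

Lemma fpart_gt0 : (0 < f)%N.
Proof. by have := pred_card_gt0; rewrite -fpartK muln_gt0 => /andP[]. Qed.

(** The powers of [beta] below its order cover all nonzero elements, so the order, a divisor of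
    [#|F|.-1], is at least that number. *)
Lemma generator_prim_root : #|F|.-1.-primitive_root beta.
Proof.
have [b0 bgen] := beta_gen.
have bq : beta ^+ #|F|.-1 = 1.
  by apply: (mulfI b0); rewrite -exprS prednK ?mulr1 ?expf_card // ltnW ?finNzRing_gt1.
have [m bm mq] := prim_order_exists pred_card_gt0 bq.
suff -> : #|F|.-1 = m by [].
apply/eqP; rewrite eqn_leq (dvdn_leq pred_card_gt0 mq) andbT.
have m0 := prim_order_gt0 bm.
rewrite -[#|F|.-1](cardC1 (0 : F)).
have : {subset predC1 (0 : F) <= [seq beta ^+ k | k : 'I_m]}.
  move=> x x0; have [k ->] := bgen x x0.
  apply/imageP; exists (Ordinal (ltn_pmod k m0)) => //=.
  by rewrite (prim_expr_mod bm).
move=> /subsetP/subset_leq_card /leq_trans; apply.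
by rewrite (leq_trans (card_size _)) // size_image card_ord.
Qed.

Lemma generator_neq0 : beta != 0. Proof. by case: beta_gen. Qed.

(** The discrete logarithm to base [beta], with default value 0 at [x = 0]. *)
Definition ind (x : F) : nat :=
  if [pick k : 'I_(#|F|.-1) | x == beta ^+ k] is Some k then val k else 0%N.

Lemma indK x : x != 0 -> beta ^+ ind x = x.
Proof.
move=> x0; rewrite /ind; case: pickP => [k /eqP -> //|h].
have [k xk] := beta_gen.2 x x0.
have := h (Ordinal (ltn_pmod k pred_card_gt0)).
by rewrite /= (prim_expr_mod generator_prim_root) xk eqxx.
Qed.

Lemma ind_exp k : ind (beta ^+ k) = k %[mod e].
Proof.
have /eqP := indK (expf_neq0 k generator_neq0).
rewrite (eq_prim_root_expr generator_prim_root) => /eqP h.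
by rewrite -(modn_dvdm _ e_dvd) h modn_dvdm.
Qed.

Lemma indM x y : x != 0 -> y != 0 -> ind (x * y) = ind x + ind y %[mod e].
Proof. by move=> x0 y0; rewrite -{1}(indK x0) -{1}(indK y0) -exprD ind_exp. Qed.

(* cyclass i is the coset beta^i (F^* )^e. *)
Definition cyclass (i : nat) (x : F) : bool := (x != 0) && (ind x == i %[mod e]).

Lemma cyclass_exp i j : cyclass i (beta ^+ (e * j + i)).
Proof.
by rewrite /cyclass expf_neq0 ?generator_neq0 //= ind_exp mulnC modnMDl.
Qed.

Lemma cyclassP i x : cyclass i x -> exists2 j, (j < f)%N & x = beta ^+ (e * j + i).
Proof.
move=> /andP[x0 /eqP xi].
(* A multiple of the order [e * f] of [beta] is added so that subtracting the arbitrary natural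
   number [i] does not truncate. *)
have iE : (i <= ind x + i * (e * f))%N.
  by rewrite (leq_trans _ (leq_addl _ _)) // leq_pmulr // muln_gt0 e_gt0 fpart_gt0.
have : (e %| ind x + i * (e * f) - i)%N.
  by rewrite -eqn_mod_dvd // mulnCA -modnDmr modnMr addn0 xi.
case/dvdnP=> t tE; exists (t %% f)%N; first by rewrite ltn_mod fpart_gt0.
rewrite -[LHS]indK //; apply/eqP; rewrite (eq_prim_root_expr generator_prim_root) -fpartK.
by rewrite muln_modr modnDml (mulnC e t) -tE subnK // -modnDmr modnMl addn0.
Qed.

Lemma cyclass_inj i : {in 'I_f &, injective (fun j : 'I_f => beta ^+ (e * j + i))}.
Proof.
move=> j k _ _ /eqP; rewrite (eq_prim_root_expr generator_prim_root) eqn_modDr.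
rewrite -fpartK -!muln_modr !modn_small // eqn_pmul2l // => /eqP; exact: val_inj.
Qed.

(** Sums over exponents become sums over a coset, where multiplicative changes of variable are
    available. *)
Lemma big_cyclass (V : nmodType) i (g : F -> V) :
  \sum_(j < f) g (beta ^+ (e * j + i)) = \sum_(x | cyclass i x) g x.
Proof.
have := @big_imset V 0 _ _ _ (fun j : 'I_f => beta ^+ (e * j + i)) 'I_f g (@cyclass_inj i).
move=> <-; apply: eq_bigl => x; apply/imsetP/idP => [[j _ ->]|/cyclassP[j jf xj]].
  exact: cyclass_exp.
by exists (Ordinal jf).
Qed.

Lemma eq_cyclass i j x : (i = j %[mod e])%N -> cyclass i x = cyclass j x.
Proof. by rewrite /cyclass => ->. Qed.

Lemma cyclassM m u i w : cyclass m u -> cyclass (m + i) (u * w) = cyclass i w.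
Proof.
case/andP=> u0 /eqP um; rewrite /cyclass mulf_eq0 negb_or u0 /=.
have [->|w0] := eqVneq w 0; first by [].
by rewrite indM // -modnDml um modnDml eqn_modDl.
Qed.

Lemma cyc_numE i j :
  cyc_num e beta i j = #|[pred w | cyclass i w && cyclass j (1 + w)]|.
Proof.
rewrite /cyc_num cardsE -!sum1_card big_mkcond /=.
rewrite -(pair_big xpredT xpredT (fun v1 v2 : 'I_f =>
  if 1 + beta ^+ (e * v1 + i) == beta ^+ (e * v2 + j) then 1%N else 0%N)) /=.
rewrite (big_cyclass i (fun w =>
  \sum_(v2 < f) if 1 + w == beta ^+ (e * v2 + j) then 1%N else 0%N)).
rewrite [RHS]big_mkcondr; apply: eq_bigr => w wi.
rewrite (big_cyclass j (fun u => if 1 + w == u then 1%N else 0%N)) big_mkcond /=.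
rewrite (bigD1 (1 + w)) //= eqxx big1 ?addr0 // => u /negPf uw.
by rewrite eq_sym uw if_same.
Qed.

Lemma DindE i : Dind e beta i = cyclass i (-1).
Proof.
apply/existsP/idP => [[y /andP[y0 /eqP ->]]|/cyclassP[j _ jE]].
  by rewrite -(indK y0) -exprM -exprD addnC mulnC cyclass_exp.
exists (beta ^+ j); rewrite expf_neq0 ?generator_neq0 //=.
by rewrite jE exprD exprM exprAC mulrC.
Qed.

Lemma sum_cyclass (V : nmodType) (G : nat -> F -> V) :
  \sum_(i < e) \sum_(x | cyclass i x) G i x = \sum_(x | x != 0) G (ind x %% e)%N x.
Proof.
rewrite (exchange_big_dep (fun x => x != 0)) => [|i x _ /andP[]//] /=.
apply: eq_bigr => x x0; have ie : (ind x %% e < e)%N by rewrite ltn_mod.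
rewrite (bigD1 (Ordinal ie)) /=; last by rewrite /cyclass x0 modn_mod eqxx.
rewrite big1 ?addr0 // => i /andP[].
rewrite /cyclass x0 => /eqP xi /negP[]; apply/eqP/val_inj => /=.
by rewrite xi modn_small.
Qed.

(** * Products of Gaussian periods and Gauss sums *)

Section Periods.
Variables (R : fieldType) (psi : F -> R).
Hypothesis psi0 : psi 0 = 1.
Hypothesis psiD : {morph psi : x y / x + y >-> x * y}.
Hypothesis psi_nontrivial : exists t, psi t != 1.

Definition period (i : nat) : R := \sum_(x | cyclass i x) psi x.

Lemma eq_period i j : i = j %[mod e] -> period i = period j.
Proof. by move=> ij; apply: eq_bigl => x; apply: eq_cyclass. Qed.

Lemma sum_psi_scaled c : c != 0 -> \sum_x psi (x * c) = 0.
Proof.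
(* Translating the summation variable by [t / c] multiplies the sum by [psi t], which differs from
   1. *)
move=> c0; case: psi_nontrivial => t psit; pose s := t / c.
suff : (1 - psi t) * \sum_x psi (x * c) == 0.
  by rewrite mulf_eq0 subr_eq0 eq_sym (negPf psit) => /eqP.
rewrite mulrBl mul1r subr_eq0 {1}(reindex_inj (addrI s)) big_distrr /=.
by apply/eqP; apply: eq_bigr => x _; rewrite mulrDl psiD divfK.
Qed.

Lemma sum_psi : \sum_(x | x != 0) psi x = -1.
Proof.
have := sum_psi_scaled (oner_neq0 F); under eq_bigr do rewrite mulr1.
by rewrite (bigD1 0) //= psi0 addrC => /eqP; rewrite addr_eq0 => /eqP.
Qed.

Lemma sum_period : \sum_(j < e) period j = -1.
Proof. by rewrite (sum_cyclass (fun _ x => psi x)) sum_psi. Qed.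

Lemma sum_periodic (V : nmodType) (h : nat -> V) k :
  (forall i j, i = j %[mod e] -> h i = h j) ->
  \sum_(i < e) h (k + i)%N = \sum_(i < e) h i.
Proof.
move=> hh; elim: k => [|k IH]; first by apply: eq_bigr.
rewrite -{}IH -!(big_mkord xpredT (fun i => h (_ + i)%N)) -(prednK e_gt0).
rewrite big_nat_recr // [RHS]big_nat_recl //= addrC; congr (_ + _).
  by apply: hh; rewrite addSn -addnS prednK // modnDr addn0.
by apply: eq_bigr => i _; rewrite addSn addnS.
Qed.

Lemma sum_period_shift m : \sum_(j < e) period (m + j) = -1.
Proof. by rewrite (sum_periodic m eq_period) sum_period. Qed.

Lemma card_cyclass i : #|[pred x | cyclass i x]| = f.
Proof. by rewrite -sum1_card -(big_cyclass i (fun=> 1%N)) sum1_card card_ord. Qed.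

(** Multiplication by a nonzero [v] of class [j] carries class [m] onto class [m + j]. The indicator
    sum over [j] lets a later sum over [v] produce cyclotomic numbers. *)
Lemma sum_cyclass_psi_scaled m v :
  \sum_(u | cyclass m u) psi (u * v) =
    (if v == 0 then f%:R else 0) + \sum_(j < e) (cyclass j v)%:R * period (m + j).
Proof.
have [->|v0] := eqVneq v 0.
  under eq_bigr do rewrite mulr0 psi0.
  rewrite sumr_const card_cyclass big1 ?addr0 // => j _.
  by rewrite /cyclass eqxx mul0r.
have ie : (ind v %% e < e)%N by rewrite ltn_mod.
rewrite add0r (bigD1 (Ordinal ie)) //= [X in _ + X]big1 => [|j].
  rewrite /cyclass v0 modn_mod eqxx mul1r addr0 /period.
  rewrite [RHS](reindex_inj (mulIf v0)); apply: eq_bigl => u.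
  rewrite (@eq_cyclass _ (ind v + m)) ?[(_ + m)%N]addnC ?modnDmr //.
  by rewrite mulrC addnC cyclassM // /cyclass v0 eqxx.
rewrite -val_eqE /= /cyclass v0 => ji; case: eqP => [vj|]; last by rewrite mul0r.
by rewrite vj modn_small ?eqxx in ji.
Qed.

(** Writing the second variable as [u * w] with [w] in class [i] turns the product of characters
    into [psi (u * (1 + w))]; the inner sum over [u] depends only on the class of [1 + w]. *)
Lemma period_mul m i :
  period m * period (m + i) =
    \sum_(j < e) ((cyc_num e beta i j)%:R - (Dind e beta i * f)%:R) * period (m + j).
Proof.
transitivity (\sum_(w | cyclass i w) \sum_(u | cyclass m u) psi (u * (1 + w))).
  rewrite exchange_big /period big_distrl /=; apply: eq_bigr => u um.
  have u0 : u != 0 by case/andP: um.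
  rewrite big_distrr (reindex_inj (mulfI u0)) /=.
  by apply: eq_big => [w|w _]; rewrite ?cyclassM // mulrDr mulr1 psiD.
under eq_bigr do rewrite sum_cyclass_psi_scaled.
rewrite big_split exchange_big /=.
under [RHS]eq_bigr do rewrite mulrBl.
rewrite big_split /= addrC; congr (_ + _).
  apply: eq_bigr => j _; rewrite -big_distrl; congr (_ * _).
  rewrite cyc_numE -sum1_card natr_sum [RHS]big_mkcondr; apply: eq_bigr => w _.
  by case: ifP.
(* Only [w = -1] gives [1 + w = 0], contributing [f] when -1 has class [i]; this constant is spread
   over the periods, whose sum is -1. *)
rewrite sumrN -big_distrr /= sum_period_shift mulrN1 opprK.
rewrite DindE -big_mkcondr big_mkcond (bigD1 (-1)) //= subrr eqxx andbT.
rewrite big1 ?addr0 => [|w]; first by case: ifP; rewrite ?mul1n.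
by rewrite addrC addr_eq0 => /negPf->; rewrite andbF.
Qed.

Definition gauss_sum (x : R) : R := \sum_(m < e) period m * x ^+ m.

Lemma root_unity_neq0 (x : R) : x ^+ e = 1 -> x != 0.
Proof.
by move=> xe; apply: contra_eq_neq xe => ->; rewrite expr0n eqn0Ngt e_gt0 eq_sym oner_eq0.
Qed.

Lemma gauss_sumE x : x ^+ e = 1 ->
  gauss_sum x = \sum_(u | u != 0) psi u * x ^+ ind u.
Proof.
move=> xe; rewrite /gauss_sum; under eq_bigr do rewrite /period big_distrl /=.
rewrite (sum_cyclass (fun m u => psi u * x ^+ m)).
by apply: eq_bigr => u _; rewrite expr_mod.
Qed.

Lemma gauss_sum_shift m x : x ^+ e = 1 ->
  \sum_(i < e) period (m + i) * x ^+ i = x^-1 ^+ m * gauss_sum x.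
Proof.
move=> xe; have x0 := root_unity_neq0 xe.
rewrite /gauss_sum -(@sum_periodic _ (fun i => period i * x ^+ i) m) => [|i j ij].
  rewrite big_distrr /=; apply: eq_bigr => i _.
  by rewrite mulrCA exprD exprVn mulKf // expf_neq0.
by rewrite (eq_period ij) (expr_root xe ij).
Qed.

(* If the Gauss sum vanished, so would sum_u psi(u t) x^(ind u) for every t, and Fourier
   inversion at u = 1 would give #|F| = 0. *)
Lemma gauss_sum_neq0 x : #|F|%:R != 0 :> R -> x ^+ e = 1 -> gauss_sum x != 0.
Proof.
move=> qR xe; have x0 := root_unity_neq0 xe.
(* The trivial character is treated apart: its Gauss sum is -1, and the proof that [S 0] vanishes
   uses [x != 1]. *)
have [->|x1] := eqVneq x 1.
  rewrite /gauss_sum; under eq_bigr do rewrite expr1n mulr1.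
  by rewrite sum_period oppr_eq0 oner_eq0.
pose S t := \sum_(u | u != 0) psi (u * t) * x ^+ ind u.
have S0 : S 0 = 0.
  rewrite /S; under eq_bigr do rewrite mulr0 psi0 mul1r -(expr_mod _ xe).
  rewrite -(sum_cyclass (fun m _ => x ^+ m)).
  under eq_bigr do rewrite sumr_const card_cyclass.
  rewrite sumrMnl (_ : \sum_(i < e) x ^+ i = 0) ?mul0rn //.
  apply/eqP; have := subrX1 x e; rewrite xe subrr => /esym/eqP.
  by rewrite mulf_eq0 subr_eq0 (negPf x1).
have St t : t != 0 -> S t = x^-1 ^+ ind t * gauss_sum x.
  move=> t0; rewrite gauss_sumE // (reindex_inj (mulIf t0)) big_distrr /=.
  apply: eq_big => [u|u u0]; first by rewrite mulf_eq0 negb_or t0 andbT.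
  rewrite mulrCA (expr_root xe (indM u0 t0)) exprD [x^-1 ^+ _ * _]mulrC exprVn.
  by rewrite mulfK // expf_neq0.
apply: contraNneq qR => G0.
have : \sum_t psi (- t) * S t = 0.
  apply: big1 => t _; have [->|t0] := eqVneq t 0; first by rewrite S0 mulr0.
  by rewrite St // G0 !mulr0.
rewrite /S; under eq_bigr do rewrite big_distrr /=.
rewrite exchange_big /= (bigD1 1) ?oner_neq0 //= [X in _ + X]big1 => [|u /andP[u0 u1]].
  move/eqP; rewrite addr0.
  under eq_bigr do rewrite mul1r mulrA -psiD addNr psi0 mul1r.
  rewrite sumr_const -(mulr_natr (x ^+ _)) mulf_eq0 => /orP[|//].
  by rewrite expf_eq0 (negPf x0) andbF.
under eq_bigr do rewrite mulrA -psiD -mulN1r [u * _]mulrC [-1 * _]mulrC -mulrDr.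
by rewrite -big_distrl sum_psi_scaled /= ?mul0r // addrC subr_eq0.
Qed.

(** Sum [period_mul] against [x ^+ i * y^-1 ^+ m] over [i] and [m], and evaluate each side by
    [gauss_sum_shift]. *)
Lemma mult_matrix_fourier x y : x ^+ e = 1 -> y ^+ e = 1 ->
  mx_fourier (mult_matrix e beta) x y * gauss_sum y^-1 =
  gauss_sum x * gauss_sum (x^-1 * y^-1).
Proof.
move=> xe ye; have x0 := root_unity_neq0 xe; have y0 := root_unity_neq0 ye.
have yVe : y^-1 ^+ e = 1 by rewrite exprVn ye invr1.
transitivity (\sum_(m < e) \sum_(i < e)
  period m * period (m + i) * x ^+ i * y^-1 ^+ m); last first.
  rewrite {2}/gauss_sum big_distrr /=; apply: eq_bigr => m _.
  rewrite -big_distrl /=; under eq_bigr do rewrite -mulrA.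
  by rewrite -big_distrr /= gauss_sum_shift // exprMn; ring.
rewrite exchange_big /mx_fourier big_distrl /=; apply: eq_bigr => i _.
under [RHS]eq_bigr do rewrite period_mul 2!big_distrl /=.
rewrite exchange_big big_distrl /=; apply: eq_bigr => j _.
rewrite -[y in y ^+ j]invrK.
rewrite -(mulrA _ (y^-1^-1 ^+ j)) -gauss_sum_shift // big_distrr /=; apply: eq_bigr => m _.
rewrite mxE rmorphB /= -!pmulrn [(j + m)%N]addnC.
have -> : (if Dind e beta i then f else 0%N) = (Dind e beta i * f)%N.
  by case: (Dind _ _ _); rewrite ?mul1n.
by ring.
Qed.

Lemma mult_matrix_char_poly (w : R) : e.-primitive_root w -> #|F|%:R != 0 :> R ->
  char_poly (map_mx intr (mult_matrix e beta)) = \prod_(i < e) ('X - (period i)%:P).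
Proof.
move=> wP qR; set C := map_mx _ _.
(* The columns of V are eigenvectors of C, by the product formula for periods. *)
pose V : 'M[R]_e := \matrix_(j, m) period (m + j).
pose D : 'M[R]_e := diag_mx (\row_m period m).
have CV : C *m V = V *m D.
  apply/matrixP => i m; rewrite mul_mx_diag !mxE mulrC period_mul.
  apply: eq_bigr => j _; rewrite !mxE rmorphB /= -!pmulrn; congr ((_ - _%:R) * _).
  by case: (Dind _ _ _); rewrite ?mul1n.
(* If [v *m V = 0], then the Fourier transform of [v] at [x] times the Gauss sum at [x^-1] is 0;
   Gauss sums do not vanish, so [v = 0]. *)
have Vu : \det V != 0.
  rewrite -unitfE -[_ \in _]/(V \in unitmx) -row_free_unit; apply: inj_row_free => v vV.
  apply/rowP => j; rewrite [RHS]mxE.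
  apply: (unity_coef_eq0 (c := fun j => v 0 j) wP) => {j} x xe.
  have xVe : x^-1 ^+ e = 1 by rewrite exprVn xe invr1.
  apply: (mulIf (gauss_sum_neq0 qR xVe)).
  rewrite mul0r big_distrl /=.
  transitivity (\sum_(m < e) (v *m V) 0 m * x^-1 ^+ m); last first.
    by rewrite vV big1 // => m _; rewrite mxE mul0r.
  under [RHS]eq_bigr do rewrite mxE big_distrl /=.
  rewrite exchange_big; apply: eq_bigr => j _ /=.
  rewrite -mulrA -{1}[x]invrK -gauss_sum_shift // big_distrr /=.
  by apply: eq_bigr => m _; rewrite mxE addnC mulrA.
have VP : \det (map_mx polyC V) != 0 by rewrite det_map_mx polyC_eq0.
transitivity (char_poly D); last first.
  rewrite char_poly_trig ?diag_mx_is_trig //.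
  by apply: eq_bigr => i _; rewrite !mxE eqxx mulr1n.
(* [V] also intertwines the characteristic matrices of [C] and [D] over the polynomial ring; its
   determinant is cancelled. *)
apply: (mulIf VP); rewrite -[LHS]det_mulmx [RHS]mulrC -[RHS]det_mulmx; congr (\det _).
rewrite /char_poly_mx mulmxBl mulmxBr -!map_mxM CV; congr (_ - _).
by rewrite mul_scalar_mx mul_mx_scalar.
Qed.

End Periods.
End Cyclotomy.

(** * The canonical additive character *)

Section TraceCharacter.
Variables (F : finFieldType) (p m : nat) (z : algC).
Hypothesis p_prime : prime p.
Hypothesis cardF : #|F| = (p ^ m)%N.
Hypothesis zP : p.-primitive_root z.

Let pcharF : p \in [pchar F]. Proof. exact: card_finPcharP cardF p_prime. Qed.

Lemma natr_eq_pchar a b : (a%:R == b%:R :> F) = (a == b %[mod p]).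
Proof.
wlog ab : a b / (a <= b)%N => [hw|].
  by case/orP: (leq_total a b) => /hw // h; rewrite eq_sym h eq_sym.
by rewrite [RHS]eq_sym eqn_mod_dvd // (dvdn_pcharf pcharF) natrB // subr_eq0 eq_sym.
Qed.

(** The [p] elements [k%:R] are already roots of ['X^p - 'X], which has no room for another. *)
Lemma pchar_expp_nat (x : F) : x ^+ p = x -> exists2 k, (k < p)%N & x = k%:R.
Proof.
move=> xp; pose s := [seq k%:R : F | k <- iota 0 p].
case: (boolP (x \in s)) => [/mapP[k]|xs].
  by rewrite mem_iota => kp xk; exists k.
have sP : size ('X^p - 'X : {poly F}) = p.+1.
  by rewrite size_polyDl ?size_polyXn // size_polyN size_polyX ltnS prime_gt1.
suff : (size (x :: s) < size ('X^p - 'X : {poly F})%R)%N.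
  by rewrite sP /= size_map size_iota ltnn.
apply: max_poly_roots; first by rewrite -size_poly_gt0 sP.
  rewrite /= {1}/root !hornerE xp subrr eqxx /=; apply/allP => _ /mapP[k _ ->].
  by rewrite /root !hornerE -(pFrobenius_autE pcharF) pFrobenius_aut_nat subrr.
rewrite /= xs /=.
rewrite map_inj_in_uniq ?iota_uniq // => i j; rewrite !mem_iota /= => ip jp /eqP.
by rewrite natr_eq_pchar !modn_small // => /eqP.
Qed.

Lemma ftraceD (x y : F) : ftrace p m (x + y) = ftrace p m x + ftrace p m y.
Proof.
rewrite /ftrace -big_split; apply: eq_bigr => k _ /=.
by rewrite exprDn_pchar // pnatX (eq_pnat _ (pcharf_eq pcharF)) pnat_id.
Qed.

Lemma ftrace_expp (x : F) : ftrace p m x ^+ p = ftrace p m x.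
Proof.
rewrite /ftrace -(pFrobenius_autE pcharF) rmorph_sum /=.
under eq_bigr do rewrite pFrobenius_autE -exprM -expnSr.
have [->|m0] := posnP m; first by rewrite !big_ord0.
rewrite -!(big_mkord xpredT (fun k => x ^+ (p ^ k))).
rewrite -(big_mkord xpredT (fun k => x ^+ (p ^ k.+1))).
rewrite -(prednK m0) big_nat_recr // [RHS]big_nat_recl //= addrC prednK //.
by rewrite -cardF expf_card expn0 expr1.
Qed.

Lemma trace_natE (x : F) : (trace_nat p m x)%:R = ftrace p m x.
Proof.
rewrite /trace_nat; case: pickP => [k /eqP -> //|h].
have [k kp xk] := pchar_expp_nat (ftrace_expp x).
by have := h (Ordinal kp); rewrite /= -xk eqxx.
Qed.

Definition trace_char (x : F) : algC := z ^+ trace_nat p m x.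

(** Any natural representative of the trace may serve as exponent, not only the one picked by
    [trace_nat]; additivity then follows at once. *)
Lemma trace_charP x k : ftrace p m x = k%:R -> trace_char x = z ^+ k.
Proof.
move=> xk; apply/eqP; rewrite (eq_prim_root_expr zP) -natr_eq_pchar trace_natE.
exact/eqP.
Qed.

Lemma trace_char0 : trace_char 0 = 1.
Proof.
rewrite (@trace_charP 0 0%N) // /ftrace big1 // => k _.
by rewrite expr0n expn_eq0 eqn0Ngt prime_gt0.
Qed.

Lemma trace_charD : {morph trace_char : x y / x + y >-> x * y}.
Proof.
by move=> x y; rewrite -exprD; apply: trace_charP; rewrite natrD !trace_natE ftraceD.
Qed.

(** The trace is a polynomial function of degree [p ^ m.-1], less than [#|F|], so it cannot vanish
    everywhere. *)
Lemma trace_char_nontrivial : exists t, trace_char t != 1.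
Proof.
have m0 : (0 < m)%N.
  by rewrite lt0n; apply: contraTneq (finNzRing_gt1 F) => m0; rewrite cardF m0.
pose P : {poly F} := \sum_(k < m) 'X^(p ^ k).
have PE x : P.[x] = ftrace p m x.
  by rewrite horner_sum; apply: eq_bigr => k _; rewrite hornerXn.
have sP : size P = (p ^ m.-1).+1.
  rewrite /P -(big_mkord xpredT (fun k => 'X^(p ^ k))) -{1}(prednK m0) big_nat_recr //=.
  rewrite addrC size_polyDl ?size_polyXn // ltnS.
  apply: (leq_trans (size_sum _ _ _)); rewrite big_mkord; apply/bigmax_leqP => k _.
  by rewrite size_polyXn ltn_exp2l ?prime_gt1.
case: (pickP (fun t => trace_char t != 1)) => [t|h]; first by exists t.
have : (size (enum F) < size P)%N.
  apply: max_poly_roots; rewrite -?size_poly_gt0 ?sP ?enum_uniq //.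
  apply/allP => x _; rewrite /root PE -trace_natE -(dvdn_pcharf pcharF).
  by rewrite (prim_order_dvd zP); have := h x => /negbFE.
rewrite sP -cardE cardF ltnS leqNgt ltn_exp2l ?prime_gt1 //.
by rewrite prednK ?leqnn.
Qed.

End TraceCharacter.

(** Transitivity of the trace: each exponent below [n * r] is [i * r + k] with [i < n] and
    [k < r]. *)
Lemma trace_char_trans (p r n : nat) (K L : finFieldType) (emb : {rmorphism K -> L})
    (z : algC) (x : L) (y : K) :
  prime p -> #|K| = (p ^ r)%N -> #|L| = (p ^ (n * r))%N -> p.-primitive_root z ->
  emb y = \sum_(i < n) x ^+ (#|K| ^ i) ->
  trace_char p (n * r) z x = trace_char p r z y.
Proof.
move=> pp cK cL zP yx; apply: (trace_charP pp cL zP).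
have pL := card_finPcharP cL pp.
rewrite -(rmorph_nat emb) (trace_natE pp cK) /ftrace rmorph_sum /=.
rewrite -(big_mkord xpredT (fun k => x ^+ (p ^ k))) big_nat_mul big_mkord.
under [RHS]eq_bigr do rewrite rmorphXn yx.
have Fr k u v : (u + v : L) ^+ (p ^ k) = u ^+ (p ^ k) + v ^+ (p ^ k).
  by rewrite exprDn_pchar // pnatX (eq_pnat _ (pcharf_eq pL)) pnat_id.
have FrS k (I : finType) (G : I -> L) : (\sum_i G i) ^+ (p ^ k) = \sum_i G i ^+ (p ^ k).
  apply: (big_morph _ (Fr k)); by rewrite expr0n expn_eq0 eqn0Ngt prime_gt0.
under [RHS]eq_bigr do rewrite FrS.
rewrite exchange_big; apply: eq_bigr => i _.
rewrite -{1}[(i * r)%N]add0n big_addn mulSn addnK big_mkord; apply: eq_bigr => k _.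
by rewrite cK -exprM -expnM -expnD addnC (mulnC r).
Qed.

(** * Lifting Gauss sums to the extension, and the matrix identity *)

Lemma cyc_char_morph (F : finFieldType) e (beta : F) (R : fieldType) (w : R) :
  (e %| #|F|.-1)%N -> is_generator beta -> w ^+ e = 1 ->
  {morph (fun x => if x == 0 then 0 else w ^+ ind beta x) : x y / x * y}.
Proof.
move=> edvd bgen we x y /=; rewrite mulf_eq0.
have [->|x0] := eqVneq x 0; first by rewrite /= mul0r.
have [->|y0] := eqVneq y 0; first by rewrite ?orbT mulr0.
by rewrite /= (expr_root we (indM edvd bgen x0 y0)) exprD.
Qed.

(** The hypothesis on [lambda] makes the character of [L] equal to [chi] composed with the norm, and
    [psiL] is [psiK] composed with the trace, so the Hasse-Davenport relation applies. *)
Lemma gauss_sum_lift (K L : finFieldType) (emb : {rmorphism K -> L}) (n e : nat)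
    (gamma : K) (lambda : L) (R : fieldType) (psiK : K -> R) (psiL : L -> R) (w : R) :
  (0 < n)%N -> (0 < e)%N -> (e %| #|K|.-1)%N -> #|L| = (#|K| ^ n)%N ->
  [pchar L].-nat #|K| -> is_generator gamma -> is_generator lambda ->
  (exists mu : K, mu != 0 /\ ffnorm K n lambda * (emb gamma)^-1 = emb (mu ^+ e)) ->
  psiK 0 = 1 -> {morph psiK : x y / x + y >-> x * y} -> (exists t, psiK t != 1) ->
  (forall x y, emb y = \sum_(i < n) x ^+ (#|K| ^ i) -> psiL x = psiK y) ->
  w ^+ e = 1 ->
  gauss_sum e lambda psiL w = (-1) ^+ n.-1 * gauss_sum e gamma psiK w ^+ n.
Proof.
move=> n0 e0 eK cL pL ggen lgen [mu [mu0 hmu]] psi0 psiD [t psit] psiL_E we.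
have g0 := generator_neq0 ggen.
have eL : (e %| #|L|.-1)%N.
  by rewrite cL -subn1 -[X in (_ - X)%N](exp1n n) subn_exp subn1 dvdn_mulr.
pose chi x : R := if x == 0 then 0 else w ^+ ind gamma x.
have chiM : {morph chi : x y / x * y} by exact: (cyc_char_morph eK ggen we).
have chi1 : chi 1 = 1.
  rewrite /chi oner_eq0 -(expr0 w); apply: (expr_root we).
  by rewrite -(expr0 gamma) ind_exp.
have chi0 : chi 0 = 0 by rewrite /chi eqxx.
have normL : rel_norm emb n lambda = gamma * mu ^+ e.
  apply: (fmorph_inj emb); rewrite emb_rel_norm // rmorphM -hmu mulrC divfK //.
  by rewrite fmorph_eq0.
have norm0 : rel_norm emb n 0 = 0.
  apply: (fmorph_inj emb); rewrite emb_rel_norm // rmorph0 /ffnorm.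
  by rewrite (bigD1 (Ordinal n0)) //= expn0 expr1 mul0r.
have normX k : rel_norm emb n (lambda ^+ k) = rel_norm emb n lambda ^+ k.
  apply: (fmorph_inj emb); rewrite rmorphXn !emb_rel_norm // /ffnorm -prodrXl.
  by apply: eq_bigr => i _; rewrite exprAC.
have HD := hasse_davenport emb n0 cL pL psi0 psiD psit chi1 chiM.
rewrite (gauss_sumE gamma e0) // (gauss_sumE lambda e0) //.
have GK : \sum_(u | u != 0) psiK u * w ^+ ind gamma u = \sum_x psiK x * chi x.
  rewrite [RHS](bigD1 0) //= chi0 mulr0 add0r; apply: eq_bigr => u /negPf u0.
  by rewrite /chi u0.
rewrite GK -HD [RHS](bigD1 0) //= norm0 chi0 mulr0 add0r.
apply: eq_bigr => x x0; congr (_ * _).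
  by apply: psiL_E; rewrite emb_rel_trace.
rewrite -{2}(indK lgen x0) normX normL /chi.
rewrite (negPf (expf_neq0 _ _)) ?mulf_neq0 ?expf_neq0 //.
(* The norm of [lambda ^+ k] is [(gamma * mu ^+ e) ^+ k], whose index to base [gamma] is [k] modulo
   [e]. *)
apply: (expr_root we); rewrite -(indK ggen mu0) -exprM -exprS -exprM ind_exp //.
by rewrite mulSn mulnAC addnC modnMDl.
Qed.

Theorem theorem1p4 (e p r n : nat) (K L : finFieldType)
  (iota : {rmorphism K -> L}) (gamma : K) (lambda : L) (z : algC) :
  (2 <= e)%N -> prime p -> (0 < r)%N -> (p ^ r = 1 %[mod e])%N -> (0 < n)%N ->
  #|K| = (p ^ r)%N -> #|L| = (p ^ (n * r))%N ->
  is_generator gamma -> is_generator lambda ->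
  (exists mu : K, mu != 0 /\ ffnorm K n lambda * (iota gamma)^-1 = iota (mu ^+ e)) ->
  p.-primitive_root z ->
  mult_matrix e lambda = (-1) ^+ n.-1 *: dcomp_pow (mult_matrix e gamma) n /\
  period_poly p (n * r) e z lambda
    = char_poly (map_mx intC ((-1) ^+ n.-1 *: dcomp_pow (mult_matrix e gamma) n)).
Proof.
move=> e2 pp r0 pe n0 cK cL ggen lgen hmu zP.
have e0 : (0 < e)%N := ltnW e2.
have eK : (e %| #|K|.-1)%N.
  by rewrite -subn1 -eqn_mod_dvd ?cK ?expn_gt0 ?prime_gt0 // pe.
have cLK : #|L| = (#|K| ^ n)%N by rewrite cK -expnM mulnC.
have eL : (e %| #|L|.-1)%N.
  by rewrite cLK -subn1 -[X in (_ - X)%N](exp1n n) subn_exp subn1 dvdn_mulr.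
have pL : [pchar L].-nat #|K|.
  by rewrite cK pnatX (eq_pnat _ (pcharf_eq (card_finPcharP cL pp))) pnat_id.
pose psiK := @trace_char K p r z; pose psiL := @trace_char L p (n * r) z.
have K0 := trace_char0 pp cK zP; have KD := trace_charD pp cK zP.
have Kt := trace_char_nontrivial pp cK zP.
have L0 := trace_char0 pp cL zP; have LD := trace_charD pp cL zP.
have Lt := trace_char_nontrivial pp cL zP.
have [w wP] := C_prim_root_exists e0.
have qK : #|K|%:R != 0 :> algC by rewrite Num.Theory.pnatr_eq0 cK -lt0n expn_gt0 prime_gt0.
have qL : #|L|%:R != 0 :> algC by rewrite Num.Theory.pnatr_eq0 cL -lt0n expn_gt0 prime_gt0.
have lift x : x ^+ e = 1 ->
    gauss_sum e lambda psiL x = (-1) ^+ n.-1 * gauss_sum e gamma psiK x ^+ n.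
  apply: (gauss_sum_lift n0 e0 eK cLK pL ggen lgen hmu K0 KD Kt) => u v uv.
  exact: (trace_char_trans pp cK cL zP uv).
have main : mult_matrix e lambda = (-1) ^+ n.-1 *: dcomp_pow (mult_matrix e gamma) n.
  apply: (mx_fourier_inj wP) => x y xe ye.
  rewrite mx_fourierZ mx_fourier_dcomp_pow // rmorphXn rmorphN1.
  have yVe : y^-1 ^+ e = 1 by rewrite exprVn ye invr1.
  have xyVe : (x^-1 * y^-1) ^+ e = 1 by rewrite exprMn exprVn xe invr1 mul1r.
  (* After multiplying by the nonzero Gauss sum of [L] at [y^-1], both sides are expressed through
     [K]; the sign [(-1) ^+ n.-1] then occurs twice on each side. *)
  apply: (mulIf (gauss_sum_neq0 e0 eL lgen L0 LD Lt qL yVe)).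
  rewrite (mult_matrix_fourier e0 eL lgen L0 LD Lt) // !lift //.
  rewrite mulrACA -(exprMn n) -(mult_matrix_fourier e0 eK ggen K0 KD Kt) // exprMn.
  by rewrite [RHS]mulrACA.
split=> //; rewrite -main.
rewrite [RHS](mult_matrix_char_poly e0 eL lgen L0 LD Lt wP qL).
by apply: eq_bigr => i _; rewrite /period -(big_cyclass e0 eL lgen).
Qed.
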